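(* Let $L$ be a finite-dimensional Lie algebra over a field $F$. (1) If $L$ is solvable and every two-generated proper subalgebra of $L$ is triangulable on $L$, then $L$ is triangulable. (2) If every proper subalgebra of $L$ is triangulable on $L$ but $L$ itself is not triangulable, then $L$ is two-generated and $L/\phi(L)$ is simple; moreover, $\bar L=L/\phi(L)$ satisfies: (a) for each maximal subalgebra $M$ of $\bar L$, either $M$ is abelian and no non-zero element of $M$ acts nilpotently on $\bar L$, or $\mathrm{nil}(M)$ is a non-zero maximal nil subalgebra of $\bar L$; (b) for each non-zero maximal nil subalgebra $K$ of $\bar L$, $N_{\bar L}(K)$ is a maximal subalgebra of $\bar L$; (c) for any two different maximal subalgebras $M_1,M_2$ of $\bar L$, no non-zero element of $M_1\cap M_2$ acts nilpotently on $\bar L$ (in particular $M_1\cap M_2$ is abelian); (d) $\bar L$ is two-generated.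
   Context: A subalgebra $S$ of a Lie algebra $L$ is triangulable on $L$ if $\mathrm{ad}_L S=\{\mathrm{ad}_L x\mid x\in S\}$ is a Lie algebra of linear transformations of $L$ which is simultaneously triangulable over the algebraic closure of $F$ (equivalently, every element of $S^2$ acts nilpotently on $L$); $L$ is triangulable if it is triangulable on itself. An element $x$ acts nilpotently on $L$ if $\mathrm{ad}_L x$ is nilpotent; a subalgebra is nil on $L$ if all its elements act nilpotently on $L$, and a maximal nil subalgebra is one maximal among subalgebras nil on $L$. For a subalgebra $S$, $\mathrm{nil}(S)$ is the unique maximal ideal of $S$ consisting of elements acting nilpotently on $L$. The Frattini ideal $\phi(L)$ is the largest ideal of $L$ contained in the intersection of all maximal subalgebras of $L$. A Lie algebra is two-generated if it is generated by two of its elements. *)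

(* Defs.v *)
From HB Require Import structures.
From mathcomp Require Import all_boot all_order all_algebra.
Set Implicit Arguments. Unset Strict Implicit. Unset Printing Implicit Defensive.
Import GRing.Theory.
Local Open Scope ring_scope.

Section Lie.
Variables (F : fieldType) (V : vectType F) (br : V -> V -> V).

Record is_lie : Prop := IsLie {
  lie_linl : forall (a : F) (x y z : V), br (a *: x + y) z = a *: br x z + br y z;
  lie_linr : forall (a : F) (x y z : V), br z (a *: x + y) = a *: br z x + br z y;
  lie_alt  : forall x : V, br x x = 0;
  lie_jacobi : forall x y z : V,
      br x (br y z) + br y (br z x) + br z (br x y) = 0 }.

(* [S, T] : the subspace spanned by all brackets [s, t], s in S, t in T. *)
Definition brsp (S T : {vspace V}) : {vspace V} :=
  <<[seq br x y | x <- (vbasis S : seq V), y <- (vbasis T : seq V)]>>%VS.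

Definition subalg (S : {vspace V}) : Prop :=
  forall x y, x \in S -> y \in S -> br x y \in S.

Definition ideal (I : {vspace V}) : Prop :=
  forall x y, y \in I -> br x y \in I.

Definition abelian (S : {vspace V}) : Prop :=
  forall x y, x \in S -> y \in S -> br x y = 0.

Definition acts_nil (x : V) : Prop :=
  exists n : nat, forall y : V, iter n (br x) y = 0.

Definition triangulable_on (S : {vspace V}) : Prop :=
  forall z, z \in brsp S S -> acts_nil z.

Definition triangulable : Prop := triangulable_on fullv.

Fixpoint derived (n : nat) : {vspace V} :=
  match n with 0 => fullv | k.+1 => brsp (derived k) (derived k) end.

Definition solvable : Prop := exists n, derived n = 0%VS.

Definition generated_by (S : {vspace V}) (x y : V) : Prop :=
  [/\ subalg S, x \in S, y \in S &
      forall T, subalg T -> x \in T -> y \in T -> (S <= T)%VS].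

Definition two_generated (S : {vspace V}) : Prop :=
  exists x y, generated_by S x y.

Definition maximal_subalg (M : {vspace V}) : Prop :=
  [/\ subalg M, M != fullv &
      forall T, subalg T -> (M <= T)%VS -> T = M \/ T = fullv].

Definition is_frattini (P : {vspace V}) : Prop :=
  [/\ ideal P,
      forall M, maximal_subalg M -> (P <= M)%VS &
      forall I, ideal I -> (forall M, maximal_subalg M -> (I <= M)%VS) ->
        (I <= P)%VS].

Definition simple : Prop :=
  (forall I, ideal I -> I = 0%VS \/ I = fullv) /\ brsp fullv fullv != 0%VS.

Definition nil_on (S : {vspace V}) : Prop := forall x, x \in S -> acts_nil x.

Definition maximal_nil (K : {vspace V}) : Prop :=
  [/\ subalg K, nil_on K &
      forall T, subalg T -> nil_on T -> (K <= T)%VS -> T = K].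

Definition ideal_of (M I : {vspace V}) : Prop :=
  (I <= M)%VS /\ forall x y, x \in M -> y \in I -> br x y \in I.

Definition is_nil_of (M N : {vspace V}) : Prop :=
  [/\ ideal_of M N, nil_on N &
      forall I, ideal_of M I -> nil_on I -> (I <= N)%VS].

Definition is_normalizer (K N : {vspace V}) : Prop :=
  forall x, x \in N <-> (forall k, k \in K -> br x k \in K).

End Lie.

Definition lie_hom (F : fieldType) (V W : vectType F)
    (brV : V -> V -> V) (brW : W -> W -> W) (f : V -> W) : Prop :=
  (forall (a : F) (x y : V), f (a *: x + y) = a *: f x + f y) /\
  (forall x y, f (brV x y) = brW (f x) (f y)).

(* Main.v *)
(** By Engel-Jacobson for a set of nilpotent elements closed under brackets,
    an algebra is triangulable as soon as each [x, y] is nilpotent; hence a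
    non-triangulable algebra with triangulable proper subalgebras is generated
    by two elements.

    If L^2 is nilpotent modulo an ideal J, take z in L^2 with Fitting null
    component U: then L = U + J, and modulo J the element z agrees with some z'
    in (U + [J, J])^2. When U + [J, J] is proper, z' is nilpotent, and z and z'
    act alike on J / [J, J]; so L^2 is nilpotent modulo [J, J]. This settles the
    solvable case. It also shows that L / phi(L) is simple: a proper nonzero
    ideal I would have a proper supplement M, and then L^2, contained in
    M^2 + I, is nilpotent modulo the solvable ideal I.

    In the simple quotient the nilpotent elements of a maximal subalgebra M form
    an ideal of M containing M^2, and the local statements follow from the fact
    that a subalgebra of a nil subalgebra is properly contained in its
    normalizer. *)
Require Import Defs.
From HB Require Import structures.
From mathcomp Require Import all_boot all_order all_algebra.
From Stdlib Require Import Classical.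
Import GRing.Theory.
Local Open Scope ring_scope.

Set Implicit Arguments. Unset Strict Implicit. Unset Printing Implicit Defensive.

(** * Subspaces given by extremality or by a predicate *)

Section Subspaces.
Variables (F : fieldType) (V : vectType F).
Implicit Types (U T : {vspace V}) (x y : V).

(** Induction on the codimension of [U]; as [Q] need not be decidable, each step asks classically
    whether a strictly larger subspace satisfies [Q]. *)
Lemma vspace_max (Q : {vspace V} -> Prop) U : Q U ->
  exists T, [/\ (U <= T)%VS, Q T & forall T', Q T' -> (T <= T')%VS -> T' = T].
Proof.
have [n] := ubnP (\dim {:V} - \dim U); elim: n U => // n IHn U leUn QU.
case: (classic (exists T, [/\ Q T, (U <= T)%VS & T <> U])) => [[T [QT UT neTU]]|noT].
  have ltUT : (\dim U < \dim T)%N.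
    rewrite ltn_neqAle dimvS // andbT; apply/eqP=> eqd; apply: neTU.
    by apply/eqP; rewrite eq_sym eqEdim UT eqd leqnn.
  have [|//|T' [TT' QT' maxT']] := IHn T.
    rewrite -ltnS; apply: leq_trans leUn; rewrite ltnS; apply: ltn_sub2l => //.
    by apply: leq_trans ltUT _; apply: dimvS; apply: subvf.
  by exists T'; split=> //; apply: subv_trans TT'.
exists U; split=> // T QT UT; apply: NNPP => neTU.
by apply: noT; exists T.
Qed.

Lemma vspace_min (Q : {vspace V} -> Prop) U : Q U ->
  exists T, [/\ (T <= U)%VS, Q T & forall T', Q T' -> (T' <= T)%VS -> T' = T].
Proof.
have [n] := ubnP (\dim U); elim: n U => // n IHn U leUn QU.
case: (classic (exists T, [/\ Q T, (T <= U)%VS & T <> U])) => [[T [QT UT neTU]]|noT].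
  have ltUT : (\dim T < \dim U)%N.
    rewrite ltn_neqAle dimvS // andbT; apply/eqP=> eqd; apply: neTU.
    by apply/eqP; rewrite eqEdim UT eqd leqnn.
  have [|//|T' [TT' QT' maxT']] := IHn T; first by rewrite -ltnS; apply: leq_trans leUn.
  by exists T'; split=> //; apply: subv_trans UT.
exists U; split=> // T QT UT; apply: NNPP => neTU.
by apply: noT; exists T.
Qed.

(** A maximal subspace inside [Q] absorbs each vector satisfying [Q], since adding its line stays
    inside [Q]. Below, this reduces a linear property on a span to its generators. *)
Lemma subspace_of_pred (Q : V -> Prop) : Q 0 ->
  (forall (a : F) x y, Q x -> Q y -> Q (a *: x + y)) ->
  exists U, forall x, x \in U <-> Q x.
Proof.
move=> Q0 QL.
have [|U [_ QU maxU]] := @vspace_max (fun U => forall x, x \in U -> Q x) 0%VS.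
  by move=> x; rewrite memv0 => /eqP->.
exists U => x; split; first exact: QU.
move=> Qx; rewrite -(maxU (<[x]> + U)%VS) ?addvSr //.
  by rewrite (subvP (addvSl _ _)) ?memv_line.
by move=> _ /memv_addP[_ /vlineP[a ->] [u uU ->]]; apply: QL => //; apply: QU.
Qed.

Lemma memv_lin U (a : F) x y : x \in U -> y \in U -> a *: x + y \in U.
Proof. by move=> xU yU; rewrite memvD ?memvZ. Qed.

Lemma lfun_of_linear (h : V -> V) : (forall a x y, h (a *: x + y) = a *: h x + h y) ->
  exists f : 'End(V), forall x, f x = h x.
Proof.
move=> hL.
pose hh : {linear V -> V} := HB.pack h (GRing.isLinear.Build F V V *:%R h hL).
by exists (linfun hh) => x; rewrite lfunE.
Qed.

End Subspaces.

(** * Bracket identities, spans of brackets and ideals *)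

Section Lie.
Variables (F : fieldType) (V : vectType F) (br : V -> V -> V).
Hypothesis HL : is_lie br.
Implicit Types (S T U I J K M N D : {vspace V}) (x y z : V).

Lemma br0l x : br 0 x = 0.
Proof. by have := lie_linl HL (-1) x x x; rewrite !scaleN1r !addNr. Qed.
Lemma br0r x : br x 0 = 0.
Proof. by have := lie_linr HL (-1) x x x; rewrite !scaleN1r !addNr. Qed.
Lemma brDl x y z : br (x + y) z = br x z + br y z.
Proof. by rewrite -[x]scale1r (lie_linl HL) !scale1r. Qed.
Lemma brDr x y z : br z (x + y) = br z x + br z y.
Proof. by rewrite -[x]scale1r (lie_linr HL) !scale1r. Qed.
Lemma brZl a x z : br (a *: x) z = a *: br x z.
Proof. by have := lie_linl HL a x 0 z; rewrite !addr0 br0l addr0. Qed.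
Lemma brZr a x z : br z (a *: x) = a *: br z x.
Proof. by have := lie_linr HL a x 0 z; rewrite !addr0 br0r addr0. Qed.
Lemma brC x y : br x y = - br y x.
Proof.
apply/eqP; rewrite -addr_eq0.
have := lie_alt HL (x + y); rewrite brDl !brDr !(lie_alt HL) add0r addr0.
by move->.
Qed.
Lemma brNr x y : br x (- y) = - br x y.
Proof. by rewrite -scaleN1r brZr scaleN1r. Qed.
Lemma br_leibniz x y z : br z (br x y) = br (br z x) y + br x (br z y).
Proof.
rewrite (brC (br z x)) (brC z y) brNr -opprD; apply/eqP; rewrite -addr_eq0.
by rewrite [_ + br x _]addrC addrA (lie_jacobi HL).
Qed.

Lemma mem_brsp S T x y : x \in S -> y \in T -> br x y \in brsp br S T.
Proof.
move=> xS yT; rewrite (coord_vbasis xS) (coord_vbasis yT).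
elim/big_ind: _ => [|u v Hu Hv|i _]; rewrite ?br0l ?mem0v ?brDl ?memvD //.
rewrite brZl memvZ //.
elim/big_ind: _ => [|u v Hu Hv|j _]; rewrite ?br0r ?mem0v ?brDr ?memvD //.
rewrite brZr memvZ // memv_span //.
by apply: allpairs_f; rewrite mem_nth ?size_tuple.
Qed.

Lemma brsp_sub S T U : (forall x y, x \in S -> y \in T -> br x y \in U) ->
  (brsp br S T <= U)%VS.
Proof.
move=> H; apply/span_subvP => _ /allpairsP[[x y] /= [xS yT ->]].
by apply: H; apply: vbasis_mem.
Qed.

Lemma brspS S S' T T' : (S <= S')%VS -> (T <= T')%VS ->
  (brsp br S T <= brsp br S' T')%VS.
Proof.
move=> /subvP sS /subvP sT; apply: brsp_sub => x y xS yT.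
by apply: mem_brsp; auto.
Qed.

Lemma iter_brspS n S T T' : (T <= T')%VS ->
  (iter n (brsp br S) T <= iter n (brsp br S) T')%VS.
Proof. by move=> TT'; elim: n => //= n IHn; apply: brspS. Qed.

Lemma subalg_brsp S : subalg br S -> (brsp br S S <= S)%VS.
Proof. by move=> sS; apply: brsp_sub. Qed.

Lemma ideal_memr I x y : ideal br I -> x \in I -> br x y \in I.
Proof. by move=> iI xI; rewrite brC memvN iI. Qed.

Lemma ideal_subalg I : ideal br I -> subalg br I.
Proof. by move=> iI x y _; apply: iI. Qed.

Lemma ideal_brsp I : ideal br I -> ideal br (brsp br I I).
Proof.
move=> iI x y yI.
have [|a u v Pu Pv|U HU] := @subspace_of_pred _ _ (fun u => br x u \in brsp br I I).
- by rewrite br0r mem0v.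
- by rewrite (lie_linr HL) memv_lin.
suff: (brsp br I I <= U)%VS by move=> /subvP/(_ y yI)/HU.
apply: brsp_sub => u v uI vI; apply/HU.
by rewrite br_leibniz memvD // mem_brsp ?iI.
Qed.

Lemma ideal_fullv : ideal br fullv.
Proof. by move=> x y _; apply: memvf. Qed.

(** * Powers of [br z] and the Fitting null component *)

Lemma iter_lin n z (a : F) x y :
  iter n (br z) (a *: x + y) = a *: iter n (br z) x + iter n (br z) y.
Proof. by elim: n => //= n ->; rewrite (lie_linr HL). Qed.

Lemma iter0v n z : iter n (br z) 0 = 0.
Proof. by elim: n => //= n ->; rewrite br0r. Qed.

Lemma iter_vanish n m z x : (n <= m)%N -> iter n (br z) x = 0 -> iter m (br z) x = 0.
Proof. by move=> /subnK <-; rewrite iterD => ->; rewrite iter0v. Qed.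

Lemma iter_mem n z x J : ideal br J -> x \in J -> iter n (br z) x \in J.
Proof. by move=> iJ xJ; elim: n => //= n IH; apply: iJ. Qed.

(** By the Leibniz rule each [br z] falls on one of the two factors, and after [a + b] of them one
    factor has been hit often enough to vanish. *)
Lemma iter_br n a b z x y : (a + b <= n)%N ->
  iter a (br z) x = 0 -> iter b (br z) y = 0 -> iter n (br z) (br x y) = 0.
Proof.
elim: n a b x y => [|n IHn] a b x y.
  by rewrite leqn0 addn_eq0 => /andP[/eqP-> _] /= -> _; rewrite br0l.
case: a => [|a]; first by move=> _ /= -> _; rewrite br0l iter0v br0r.
case: b => [|b]; first by move=> _ _ /= ->; rewrite br0r iter0v br0r.
move=> leabn xa yb; rewrite iterSr br_leibniz -[br (br z x) y]scale1r iter_lin.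
rewrite (IHn a b.+1) ?(IHn a.+1 b) ?scaler0 ?addr0 //; rewrite -?iterSr //.
by move: leabn; rewrite addnS addSn.
Qed.

(** The vectors killed by some power form a subspace; the largest exponent needed on a basis serves
    for all of it. *)
Lemma fitting_null_uniform z : exists n, forall m x,
  iter m (br z) x = 0 -> iter n (br z) x = 0.
Proof.
have [||U HU] := @subspace_of_pred _ _ (fun x => exists m, iter m (br z) x = 0).
- by exists 0.
- move=> a x y [m xm] [k yk]; exists (maxn m k).
  by rewrite iter_lin !(iter_vanish _ xm, iter_vanish _ yk) ?leq_maxl ?leq_maxr
             ?scaler0 ?addr0.
have [n Hn] : exists n, forall x, x \in (vbasis U : seq V) -> iter n (br z) x = 0.
  have: forall x, x \in (vbasis U : seq V) -> x \in U by move=> x; apply: vbasis_mem.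
  elim: (vbasis U : seq V) => [|v s IHs] Hs; first by exists 0.
  have [|n Hn] := IHs; first by move=> x xs; apply: Hs; rewrite inE xs orbT.
  have /HU[m vm] : v \in U by apply: Hs; rewrite inE eqxx.
  exists (maxn m n) => x; rewrite inE => /orP[/eqP->|/Hn xn].
    by apply: iter_vanish vm; rewrite leq_maxl.
  by apply: iter_vanish xn; rewrite leq_maxr.
have [||U' HU'] := @subspace_of_pred _ _ (fun x => iter n (br z) x = 0).
- exact: iter0v.
- by move=> a x y xn yn; rewrite iter_lin xn yn scaler0 addr0.
exists n => m x xm; apply/HU'; have xU : x \in U by apply/HU; exists m.
have: (U <= U')%VS.
  by rewrite -(span_basis (vbasisP U)); apply/span_subvP => v /Hn/HU'.
by move/subvP; apply.
Qed.

(** The last clause is Fitting's decomposition: [U] is the kernel of a high power of [br z] and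
    meets its image trivially, so by dimension the two fill [V]. *)
Lemma fitting z : exists n U,
  [/\ forall x, x \in U <-> iter n (br z) x = 0,
      subalg br U &
      forall J m, ideal br J -> (forall x, iter m (br z) x \in J) ->
        (U + J)%VS = fullv].
Proof.
have [n Hn] := fitting_null_uniform z.
have [||U HU] := @subspace_of_pred _ _ (fun x => iter n (br z) x = 0).
- exact: iter0v.
- by move=> a x y xn yn; rewrite iter_lin xn yn scaler0 addr0.
exists n, U; split=> // [x y /HU xn /HU yn|J m iJ mJ].
  by apply/HU; apply: (Hn (n + n)%N); apply: iter_br xn yn.
(* The summand [m] puts the image inside [J]; the summand [n] makes the kernel equal to [U]. *)
have [|f Hf] := @lfun_of_linear _ V (iter (m + n) (br z)).
  by move=> a x y; rewrite iter_lin.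
have kerf : lker f = U.
  apply/vspaceP => x; rewrite memv_ker Hf; apply/eqP/idP => [/Hn/HU//|/HU].
  by apply: iter_vanish; rewrite leq_addl.
have imf : (limg f <= J)%VS.
  by apply/subvP => _ /memv_imgP[x _ ->]; rewrite Hf iterD.
apply/eqP; rewrite eqEsubv subvf /=.
apply: subv_trans (addvS (subvv U) imf).
have disj : (U :&: limg f = 0)%VS.
  apply/eqP; rewrite -subv0; apply/subvP => u /memv_capP[/HU un /memv_imgP[v _ uE]].
  move: un; rewrite uE memv0 !Hf -iterD => /Hn.
  by move/(iter_vanish (leq_addl m n)) ->.
rewrite -(geq_leqif (dimv_leqif_sup (subvf _))) dimv_disjoint_sum // -kerf.
by rewrite -(limg_ker_dim f fullv) capfv.
Qed.

(** * The Engel-Jacobson theorem *)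

(** Nilpotency of the associative algebra generated by the maps [br t], [t] in [T]: every product of
    [n] of them vanishes. *)
Definition assoc_nil T : Prop := exists n, iter n (brsp br T) fullv = 0%VS.

Lemma assoc_nilS S T : (S <= T)%VS -> assoc_nil T -> assoc_nil S.
Proof.
move=> ST [n Tn]; exists n; apply/eqP; rewrite -subv0 -Tn.
by elim: n {Tn} => //= n IHn; apply: brspS.
Qed.

Lemma assoc_nil_nil_on T : assoc_nil T -> nil_on br T.
Proof.
move=> [n Tn] x xT; exists n => y; apply/eqP; rewrite -memv0 -Tn.
elim: n {Tn} => [|n IHn] /=; first exact: memvf.
exact: mem_brsp.
Qed.

(* Starting outside [U] and bracketing with elements of [S], one must reach
   [U] in a bounded number of steps; stop just before. *)
Lemma last_outside (S Q : V -> Prop) D U w : assoc_nil D ->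
  (forall t, S t -> t \in D) -> (forall t v, S t -> Q v -> Q (br t v)) ->
  Q w -> w \notin U ->
  exists v, [/\ Q v, v \notin U & forall t, S t -> br t v \in U].
Proof.
move=> [n Dn] SD QS Qw wU; apply: NNPP => nov.
suff [v [_ vU]]: exists v, [/\ Q v, v \notin U & v \in iter n (brsp br D) fullv].
  by rewrite Dn memv0 => /eqP v0; rewrite v0 mem0v in vU.
elim: n {Dn} => [|n [v [Qv vU vn]]]; first by exists w; rewrite memvf.
apply: NNPP => nov'; apply: nov; exists v; split=> // t St.
apply/negPn/negP => tvU; apply: nov'; exists (br t v).
by split; [exact: QS | | apply: mem_brsp; auto].
Qed.

Lemma assoc_nil_line w : acts_nil br w -> assoc_nil <[w]>.
Proof.
move=> [n wn]; exists n.
suff H k u : u \in iter k (brsp br <[w]>) fullv -> exists v, u = iter k (br w) v.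
  apply/eqP; rewrite -subv0; apply/subvP => u /H[v ->].
  by rewrite wn mem0v.
elim: k u => [|k IHk] u /=; first by exists u.
have [||U HU] := @subspace_of_pred _ _ (fun u => exists v, u = br w (iter k (br w) v)).
- by exists 0; rewrite iter0v br0r.
- by move=> a _ _ [v ->] [v' ->]; exists (a *: v + v'); rewrite iter_lin (lie_linr HL).
suff /subvP sU : (brsp br <[w]> (iter k (brsp br <[w]>) fullv) <= U)%VS by move/sU/HU.
apply: brsp_sub => _ v /vlineP[a ->] /IHk[v' ->]; apply/HU.
by exists (a *: v'); rewrite brZl -[a *: v']addr0 iter_lin iter0v addr0 brZr.
Qed.

(** Filter [V] by the iterated brackets [A i] with [T]. As [w] normalizes [T], it preserves each
    [A i]; on [A i] modulo [A i.+1] only [w] acts, so [m] brackets descend one layer and [n * m]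
    reach zero. *)
Lemma assoc_nil_add_line T w : assoc_nil T -> acts_nil br w ->
  (forall t, t \in T -> br t w \in T) -> assoc_nil (T + <[w]>).
Proof.
move=> [n Tn] /assoc_nil_line[m wm] Tw.
pose A i := iter i (brsp br T) fullv.
have Aw i u : u \in A i -> br w u \in A i.
  elim: i u => [|i IHi] u; first by rewrite !memvf.
  have [||U HU] := @subspace_of_pred _ _ (fun u => br w u \in A i.+1).
  - by rewrite br0r mem0v.
  - by move=> a x y xA yA; rewrite (lie_linr HL) memv_lin.
  suff /subvP sU : (A i.+1 <= U)%VS by move/sU/HU.
  apply: brsp_sub => x y xT yA; apply/HU.
  rewrite br_leibniz memvD //; apply: mem_brsp => //; last exact: IHi.
  by rewrite brC memvN Tw.
have AS i : (A i.+1 <= A i)%VS.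
  elim: i => [|i IHi]; first exact: subvf.
  exact: brspS.
pose B i k := iter k (brsp br <[w]>) (A i).
have BA i k : (B i k <= A i)%VS.
  elim: k => [|k /subvP IHk] //=; apply: brsp_sub => _ y /vlineP[a ->] /IHk yA.
  by rewrite brZl memvZ ?Aw.
have step i k :
    (brsp br (T + <[w]>) (B i k + A i.+1) <= B i k.+1 + A i.+1)%VS.
  apply: brsp_sub => x y /memv_addP[t tT [_ /vlineP[a ->] ->]].
  move=> /memv_addP[b bB [c cA ->]]; have bA := subvP (BA i k) _ bB.
  rewrite addrC brDl brDr -addrA memv_add //.
    by apply: mem_brsp => //; rewrite memvZ ?memv_line.
  rewrite brZl memvD ?memvZ ?Aw // brDr memvD //; apply: mem_brsp => //.
  exact: (subvP (AS i)).
have layer i : (iter m (brsp br (T + <[w]>)) (A i) <= A i.+1)%VS.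
  have Bm : (B i m <= A i.+1)%VS.
    apply: subv_trans (sub0v _); rewrite -wm /B.
    exact/iter_brspS/subvf.
  apply: (@subv_trans _ _ (B i m + A i.+1)%VS); last by rewrite subv_add Bm subvv.
  elim: m {wm Bm} => [|k IHk]; first exact: addvSl.
  exact: subv_trans (brspS (subvv _) IHk) (step i k).
exists (n * m)%N; apply/eqP; rewrite -subv0 -Tn -[iter n _ _]/(A n).
elim: n {Tn} => [|i IHi]; first exact: subvf.
rewrite mulSn iterD; apply: subv_trans (layer i).
exact: iter_brspS.
Qed.

(** Take [T] maximal among associatively nilpotent subalgebras spanned by elements of [W]. If [W] is
    not inside [T], some [w] of [W] outside [T] normalizes [T], and [T + <[w]>] contradicts
    maximality. *)
Theorem engel_jacobson (W : V -> Prop) :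
  (forall x y, W x -> W y -> W (br x y)) -> (forall x, W x -> acts_nil br x) ->
  exists T, [/\ assoc_nil T, forall x, W x -> x \in T &
    forall U, (forall x, W x -> x \in U) -> (T <= U)%VS].
Proof.
move=> Wbr Wnil.
(* The third clause says that the elements of [W] in [T] span [T]. *)
pose good T := [/\ assoc_nil T, subalg br T &
  forall U, (forall x, W x -> x \in T -> x \in U) -> (T <= U)%VS].
have [|T [_ [nilT sT genT] maxT]] := @vspace_max _ _ good 0%VS.
  split=> [|x y|U _]; last exact: sub0v.
    exists 1; apply/eqP; rewrite -subv0; apply: brsp_sub => x y.
    by rewrite memv0 => /eqP->; rewrite br0l mem0v.
  by rewrite !memv0 => /eqP-> _; rewrite br0l.
exists T; split=> // [x Wx|U WU]; last by apply: genT => x /WU.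
apply/negPn/negP => xT.
have [||||w [Ww wT Tw]] := @last_outside (fun t => W t /\ t \in T) W T T x nilT.
- by move=> t [].
- by move=> t v [Wt _]; apply: Wbr.
- by [].
- by [].
have {}Tw t : t \in T -> br t w \in T.
  have [||U HU] := @subspace_of_pred _ _ (fun t => br t w \in T).
  - by rewrite br0l mem0v.
  - by move=> a y z yT zT; rewrite (lie_linl HL) memv_lin.
  have /subvP sU: (T <= U)%VS by apply: genT => y Wy yT; apply/HU/Tw.
  by move/sU/HU.
suff E : (T + <[w]>)%VS = T by rewrite -E (subvP (addvSr _ _)) ?memv_line in wT.
apply: maxT; last exact: addvSl.
split; first exact: assoc_nil_add_line (Wnil w Ww) Tw.
  move=> x1 y1 /memv_addP[t tT [_ /vlineP[a ->] ->]].
  move=> /memv_addP[u uT [_ /vlineP[b ->] ->]].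
  apply: (subvP (addvSl _ _)); rewrite brDl !brDr !brZl !brZr (lie_alt HL).
  have wuT : br w u \in T by rewrite brC memvN Tw.
  by rewrite !scaler0 ?addr0 !memvD ?memvZ ?wuT ?Tw ?sT.
move=> U HU; rewrite subv_add; apply/andP; split.
  by apply: genT => y Wy yT; apply: HU => //; apply: (subvP (addvSl _ _)).
rewrite -memvE; apply: HU => //.
by rewrite (subvP (addvSr _ _)) ?memv_line.
Qed.

Lemma engel T : subalg br T -> nil_on br T -> assoc_nil T.
Proof.
move=> sT nT; have [U [nU TU _]] := engel_jacobson sT nT.
by apply: assoc_nilS nU; apply/subvP.
Qed.

Lemma subalg_der S : subalg br S -> subalg br (brsp br S S).
Proof.
by move=> sS x y /(subvP (subalg_brsp sS)) xS /(subvP (subalg_brsp sS)); apply: mem_brsp.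
Qed.

(** The set of single brackets is closed under [br], so Engel-Jacobson passes nilpotency to its
    span. *)
Lemma triangulable_of_brackets S : subalg br S ->
  (forall x y, x \in S -> y \in S -> acts_nil br (br x y)) -> triangulable_on br S.
Proof.
move=> sS Snil.
pose W z := exists x y, [/\ x \in S, y \in S & z = br x y].
have [||T [nT WT _]] := @engel_jacobson W.
- move=> _ _ [x [y [xS yS ->]]] [u [v [uS vS ->]]].
  by exists (br x y), (br u v); rewrite !sS.
- by move=> _ [x [y [xS yS ->]]]; apply: Snil.
have /subvP sub : (brsp br S S <= T)%VS.
  by apply: brsp_sub => x y xS yS; apply: WT; exists x, y.
by move=> z /sub; apply: assoc_nil_nil_on.
Qed.

(** * Generation and maximal subalgebras *)

Lemma generated_exists x y : exists S, generated_by br S x y.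
Proof.
have [|S [_ [sS xS yS] minS]] :=
  @vspace_min _ _ (fun S => [/\ subalg br S, x \in S & y \in S]) fullv.
  by split; rewrite ?memvf // => u v _ _; rewrite memvf.
exists S; split=> // T sT xT yT.
rewrite -(minS (S :&: T)%VS) ?capvSl ?capvSr //; split; rewrite ?memv_cap ?xS ?yS //.
move=> u v /memv_capP[uS uT] /memv_capP[vS vT].
by rewrite memv_cap sS // sT.
Qed.

Lemma triangulable_of_two_generated S : subalg br S ->
  (forall T, subalg br T -> (T <= S)%VS -> two_generated br T ->
     triangulable_on br T) ->
  triangulable_on br S.
Proof.
move=> sS HS; apply: triangulable_of_brackets => // x y xS yS.
have [T [sT xT yT minT]] := generated_exists x y.
by apply: (HS T) => //; [exact: minT | exists x, y | exact: mem_brsp].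
Qed.

Lemma subalg_fullv : subalg br fullv.
Proof. by move=> x y _ _; apply: memvf. Qed.

Lemma sub_maximal_subalg S : subalg br S -> S != fullv ->
  exists M, maximal_subalg br M /\ (S <= M)%VS.
Proof.
move=> sS nS.
have [//|M [SM [sM nM] maxM]] :=
  @vspace_max _ _ (fun S => subalg br S /\ S != fullv) S.
exists M; split=> //; split=> // T sT MT.
by case: (eqVneq T fullv) => [|nT]; [right | left; apply: maxM].
Qed.

(** * Lifting nilpotency along abelian ideals *)

(** For an ideal [J] this is triangulability of the quotient by [J], stated without forming the
    quotient. *)
Definition nil_mod J : Prop := forall z, z \in brsp br fullv fullv ->
  exists n, forall x, iter n (br z) x \in J.

Lemma brsp_full_add S J : ideal br J -> (S + J)%VS = fullv ->
  (brsp br fullv fullv <= brsp br S S + J)%VS.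
Proof.
move=> iJ SJ; rewrite -{1 2}SJ.
apply: brsp_sub => x y /memv_addP[a aS [u uJ ->]] /memv_addP[b bS [v vJ ->]].
rewrite brDl brDr -addrA memv_add ?mem_brsp // memvD //; first exact: iJ.
exact: ideal_memr.
Qed.

Lemma iter_congr z z' I : ideal br I -> z - z' \in I ->
  forall n x, iter n (br z) x - iter n (br z') x \in I.
Proof.
move=> iI zz' n x; elim: n => [|n IHn] /=; first by rewrite subrr mem0v.
set u := iter n (br z) x in IHn *; set v := iter n (br z') x in IHn *.
have -> : br z u - br z' v = br z (u - v) + br (z - z') v.
  by rewrite brDr brNr brDl addrA subrK -[- z']scaleN1r brZl scaleN1r.
by apply: memvD; [exact: iI | exact: ideal_memr].
Qed.

Hypothesis properT : forall S, subalg br S -> S != fullv -> triangulable_on br S.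

Lemma subalg_add_ideal S I : subalg br S -> ideal br I -> subalg br (S + I).
Proof.
move=> sS iI _ _ /memv_addP[a aS [u uJ ->]] /memv_addP[b bS [v vJ ->]].
rewrite brDl brDr -addrA memv_add ?sS // memvD //; first exact: iI.
exact: ideal_memr.
Qed.

(** If [U + I] is everything, a power of [br z] kills [U] and so maps into [I]. Otherwise
    [z = z' + j] with [z'] nilpotent and [j] in [J], and [br j] maps [J] into [I]. *)
Lemma nil_mod_step J I : ideal br J -> ideal br I -> (I <= J)%VS ->
  (brsp br J J <= I)%VS -> nil_mod J -> nil_mod I.
Proof.
move=> iJ iI IJ JJI nJ z zL; have [m zm] := nJ z zL.
have [n [U [HU sU decU]]] := fitting z.
have UJ := decU J m iJ zm.
case: (eqVneq (U + I)%VS fullv) => [UI|nUI].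
  exists n => x; have: x \in (U + I)%VS by rewrite UI memvf.
  move=> /memv_addP[u /HU un [v vI ->]].
  by rewrite -[u]scale1r iter_lin un scaler0 add0r iter_mem.
have HJ : (U + I + J)%VS = fullv.
  by apply/eqP; rewrite eqEsubv subvf -UJ addvS ?addvSl.
have sH := subalg_add_ideal sU iI.
have /memv_addP[z' z'H [j jJ zE]] := subvP (brsp_full_add iJ HJ) _ zL.
have [k z'k] := properT sH nUI z'H.
(* The first [m] brackets enter [J]; there [z] and [z'] agree modulo [I], so [k] more enter [I]. *)
exists (k + m)%N => x; rewrite iterD; move: (zm x); move: (iter m _ x) => y yJ.
suff H : iter k (br z) y - iter k (br z') y \in I by rewrite z'k subr0 in H.
elim: k {z'k} => [|k IHk] /=; first by rewrite subrr mem0v.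
set u := iter k (br z) y in IHk *; set v := iter k (br z') y in IHk *.
have vJ : v \in J by apply: iter_mem.
have -> : br z u - br z' v = br z (u - v) + br j v.
  have zv : br z v = br z' v + br j v by rewrite -brDl -zE.
  by rewrite brDr brNr zv opprD addrA subrK.
apply: memvD; first exact: iI.
by rewrite (subvP JJI) // mem_brsp.
Qed.

Lemma triangulable_of_nil_mod n J : ideal br J -> nil_mod J ->
  iter n (fun J => brsp br J J) J = 0%VS -> triangulable br.
Proof.
elim: n J => [|n IHn] J iJ nJ; first by move=> /= J0 z /nJ[k zk]; exists k => x;
  apply/eqP; rewrite -memv0 -J0.
rewrite iterSr => Jn; apply: (IHn _ _ _ Jn); first exact: ideal_brsp.
apply: (nil_mod_step iJ) => //; first exact: ideal_brsp.
by apply: subalg_brsp; apply: ideal_subalg.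
Qed.

Lemma solvable_triangulable : solvable br -> triangulable br.
Proof.
move=> [n Dn]; apply: (@triangulable_of_nil_mod n fullv); first exact: ideal_fullv.
  by move=> z _; exists 0 => x; apply: memvf.
by rewrite -Dn; elim: n {Dn} => //= n ->.
Qed.

(** By Engel the derived subalgebra of [I] is associatively nilpotent. One derivation enters it,
    hence [n.+1]; each later term lies in the next iterated bracket with it. *)
Lemma triangulable_ideal_solvable I : ideal br I -> triangulable_on br I ->
  exists n, iter n (fun J => brsp br J J) I = 0%VS.
Proof.
move=> iI tI; have sI := ideal_subalg iI.
have [n Tn] := engel (subalg_der sI) tI.
exists n.+1; apply/eqP; rewrite -subv0 -Tn.
have sub k : (iter k.+1 (fun J => brsp br J J) I <= brsp br I I)%VS.
  elim: k => [|k IHk] //=; apply: subv_trans (brspS IHk IHk) _.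
  exact: brspS (subalg_brsp sI) (subalg_brsp sI).
elim: n {Tn} => [|n IHn]; first exact: subvf.
by rewrite iterS; apply: brspS.
Qed.

(** * Subalgebras of a non-triangulable algebra *)

Hypothesis notT : ~ triangulable br.

Lemma full_two_generated : two_generated br fullv.
Proof.
apply: NNPP => n2; apply: notT; apply: triangulable_of_two_generated.
  exact: subalg_fullv.
move=> T sT _ T2; apply: properT => //; apply: contra_notN n2 => /eqP TE.
by rewrite -TE.
Qed.

Lemma no_supplement M I : subalg br M -> M != fullv -> ideal br I ->
  I != fullv -> (M + I)%VS <> fullv.
Proof.
move=> sM nM iI nI MI; apply: notT.
have [n In] := triangulable_ideal_solvable iI (properT (ideal_subalg iI) nI).
apply: (triangulable_of_nil_mod iI _ In) => z /(subvP (brsp_full_add iI MI)).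
move=> /memv_addP[z' z'M [i iI' ->]]; have [k z'k] := properT sM nM z'M.
exists k => x; have := @iter_congr (z' + i) z' I iI _ k x.
by rewrite addrC addKr z'k subr0; apply.
Qed.

(** Triangulability closes the nilpotent elements under brackets, so by Engel-Jacobson their span is
    still nil and adds nothing new. *)
Lemma nilpotent_elements S : subalg br S -> triangulable_on br S ->
  exists N, forall x, x \in N <-> x \in S /\ acts_nil br x.
Proof.
move=> sS tS.
have [||T [nT WT genT]] := @engel_jacobson (fun x => x \in S /\ acts_nil br x).
- by move=> x y [xS _] [yS _]; split; [exact: sS | apply/tS/mem_brsp].
- by move=> x [].
exists T => x; split=> [xT|/WT//]; split; last exact: assoc_nil_nil_on xT.
by apply: (subvP (genT S _)) => // y [].
Qed.

Lemma normalizer_exists K : exists N, is_normalizer br K N.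
Proof.
have [||N HN] := @subspace_of_pred _ _ (fun x => forall k, k \in K -> br x k \in K).
- by move=> k _; rewrite br0l mem0v.
- by move=> a x y xK yK k kK; rewrite (lie_linl HL) memv_lin ?xK ?yK.
by exists N.
Qed.

Lemma subalg_normalizer K N : is_normalizer br K N -> subalg br N.
Proof.
move=> HN x y /HN xK /HN yK; apply/HN => k kK.
have -> : br (br x y) k = br x (br y k) - br y (br x k).
  by rewrite (br_leibniz y k x) addrK.
by rewrite memvB ?xK ?yK ?xK.
Qed.

Lemma nil_proper K : nil_on br K -> K != fullv.
Proof.
move=> nK; apply/eqP => KE; apply: notT => z _; apply: nK.
by rewrite KE memvf.
Qed.

(** Bracketing with [D] eventually drives any element of [T] into [D]; the last one still outside
    normalizes [D]. *)
Lemma normalizer_grows D T : subalg br T -> nil_on br T -> (D <= T)%VS -> D <> T ->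
  exists t, [/\ t \in T, t \notin D & forall d, d \in D -> br t d \in D].
Proof.
move=> sT nT DT neDT.
have [w [wT wD]] : exists w, w \in T /\ w \notin D.
  apply: NNPP => now; apply: neDT; apply/eqP; rewrite eqEsubv DT /=.
  apply/subvP => w wT; apply/negPn/negP => wD.
  by apply: now; exists w.
have [||||t [tT tD Dt]] := @last_outside (fun d => d \in D) (fun t => t \in T) D D w
  (assoc_nilS DT (engel sT nT)).
- by [].
- by move=> d v /(subvP DT) dT; apply: sT.
- by [].
- by [].
by exists t; split=> // d dD; rewrite brC memvN Dt.
Qed.

(** * Maximal subalgebras and their nil ideals, in the absence of proper nonzero ideals *)

Hypothesis no_ideal : forall I, ideal br I -> I = 0%VS \/ I = fullv.

Lemma normalizer_proper K N : nil_on br K -> K != 0%VS -> is_normalizer br K N ->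
  N != fullv.
Proof.
move=> nK K0 HN; apply/eqP => NE.
have [|KE|KE] := no_ideal (I := K).
- by move=> x y; apply: (HN x).1; rewrite NE memvf.
- by rewrite KE eqxx in K0.
- by have := nil_proper nK; rewrite KE eqxx.
Qed.

(** For maximal [M] this is nil([M]): the set of all nilpotent elements of [M] contains every
    bracket of [M], hence is an ideal of [M]. *)
Definition nilrad M N := forall x, x \in N <-> x \in M /\ acts_nil br x.

Lemma nilrad_exists M : maximal_subalg br M -> exists N, nilrad M N.
Proof. by move=> [sM nM _]; apply: nilpotent_elements => //; apply: properT. Qed.

Lemma nilrad_nil M N : nilrad M N -> nil_on br N.
Proof. by move=> HN x /HN[]. Qed.

Lemma nilrad_sub M N : nilrad M N -> (N <= M)%VS.
Proof. by move=> HN; apply/subvP => x /HN[]. Qed.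

Lemma nilrad_br M N x y : maximal_subalg br M -> nilrad M N ->
  x \in M -> y \in M -> br x y \in N.
Proof.
move=> [sM nM _] HN xM yM; apply/HN; split; first exact: sM.
by apply: (properT sM nM); apply: mem_brsp.
Qed.

Lemma nilrad_subalg M N : maximal_subalg br M -> nilrad M N -> subalg br N.
Proof. by move=> mM HN x y /HN[xM _] /HN[yM _]; apply: (nilrad_br mM HN). Qed.

Lemma nilrad_normalizer M N : maximal_subalg br M -> nilrad M N -> N != 0%VS ->
  is_normalizer br N M.
Proof.
move=> mM HN N0; have [C HC] := normalizer_exists N.
have MC : (M <= C)%VS.
  apply/subvP => x xM; apply/HC => k /HN[kM _]; exact: (nilrad_br mM HN).
have nC := normalizer_proper (nilrad_nil HN) N0 HC.
case: (mM) => _ _ /(_ _ (subalg_normalizer HC) MC)[CM|CE]; first by rewrite -CM.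
by rewrite CE eqxx in nC.
Qed.

(** A larger nil subalgebra would have an element outside [N] normalizing [N]; it would lie in [M],
    the normalizer of [N], and so in [N]. *)
Lemma nilrad_maximal_nil M N : maximal_subalg br M -> nilrad M N -> N != 0%VS ->
  maximal_nil br N.
Proof.
move=> mM HN N0; split; [exact: nilrad_subalg HN | exact: nilrad_nil HN |].
move=> T sT nT NT; apply: NNPP => neTN.
have [|t [tT tN /(nilrad_normalizer mM HN N0) tM]] := normalizer_grows sT nT NT.
  by move=> E; apply: neTN.
by move/negP: tN; apply; apply/HN; split=> //; apply: nT.
Qed.

Lemma maximal_subalg_dichotomy M : maximal_subalg br M ->
  (abelian br M /\ (forall x, x \in M -> acts_nil br x -> x = 0)) \/
  (exists N, is_nil_of br M N /\ N != 0%VS /\ maximal_nil br N).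
Proof.
move=> mM; have [N HN] := nilrad_exists mM.
case: (eqVneq N 0%VS) => [N0|N0]; [left | right].
  split=> [x y xM yM|x xM nx].
    by apply/eqP; rewrite -memv0 -N0 (nilrad_br mM HN).
  by apply/eqP; rewrite -memv0 -N0; apply/HN.
exists N; split; last by split=> //; apply: nilrad_maximal_nil HN N0.
split; [split; first exact: nilrad_sub HN | exact: nilrad_nil HN |].
  by move=> x y xM /HN[yM _]; apply: (nilrad_br mM HN).
move=> I [/subvP IM _] nI; apply/subvP => x xI.
by apply/HN; split; [exact: IM | exact: nI].
Qed.

(** A maximal subalgebra [M] above [N] has a nilradical containing [K], hence equal to [K]; thus [M]
    normalizes [K] and lies in [N]. *)
Lemma maximal_nil_normalizer K N : maximal_nil br K -> K != 0%VS ->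
  is_normalizer br K N -> maximal_subalg br N.
Proof.
move=> [sK nK maxK] K0 HN; have sN := subalg_normalizer HN.
have [M [mM NM]] := sub_maximal_subalg sN (normalizer_proper nK K0 HN).
have [R HR] := nilrad_exists mM.
have KR : (K <= R)%VS.
  apply/subvP => x xK; apply/HR; split; last exact: nK.
  by apply: (subvP NM); apply/HN => k kK; apply: sK.
have RK := maxK R (nilrad_subalg mM HR) (nilrad_nil HR) KR.
suff -> : N = M by [].
apply/eqP; rewrite eqEsubv NM /=; apply/subvP => x xM; apply/HN => k.
rewrite -RK => /HR[kM _]; exact: (nilrad_br mM HR).
Qed.

Lemma nilrad_inj M1 M2 N : maximal_subalg br M1 -> maximal_subalg br M2 ->
  nilrad M1 N -> nilrad M2 N -> N != 0%VS -> M1 = M2.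
Proof.
move=> m1 m2 H1 H2 N0; apply/vspaceP => x; apply/idP/idP.
  by move/(nilrad_normalizer m1 H1 N0)/(nilrad_normalizer m2 H2 N0).
by move/(nilrad_normalizer m2 H2 N0)/(nilrad_normalizer m1 H1 N0).
Qed.

(* For an intersection [D] of two such nilradicals that is maximal among the
   nonzero ones, the normalizer of [D] lies in a maximal subalgebra whose
   nilradical meets both in more than [D]. *)
Lemma nilrad_cap M1 M2 N1 N2 : maximal_subalg br M1 -> maximal_subalg br M2 ->
  M1 <> M2 -> nilrad M1 N1 -> nilrad M2 N2 -> (N1 :&: N2)%VS = 0%VS.
Proof.
move=> m1 m2 ne12 H1 H2; apply: NNPP => /eqP D0.
pose Q D := D != 0%VS /\ exists M1 M2 N1 N2, [/\ maximal_subalg br M1 /\ maximal_subalg br M2,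
  M1 <> M2, nilrad M1 N1, nilrad M2 N2 & D = (N1 :&: N2)%VS].
have [|D [_ [{}D0 QD] maxD]] := @vspace_max _ _ Q (N1 :&: N2)%VS.
  by split=> //; exists M1, M2, N1, N2.
case: QD => {M1 M2 N1 N2 m1 m2 ne12 H1 H2} M1 [M2 [N1 [N2 [[m1 m2] ne12 H1 H2 DE]]]].
have D1 : (D <= N1)%VS by rewrite DE capvSl.
have D2 : (D <= N2)%VS by rewrite DE capvSr.
have nD : nil_on br D by move=> x /(subvP D1)/(nilrad_nil H1).
have [C HC] := normalizer_exists D.
have [M [mM CM]] := sub_maximal_subalg (subalg_normalizer HC) (normalizer_proper nD D0 HC).
have [N HN] := nilrad_exists mM.
have not0 M' N' : nilrad M' N' -> (D <= N')%VS -> N' != 0%VS.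
  by move=> _ DN'; apply: contraNneq D0 => N'0; rewrite -subv0 -N'0.
(* An element [t] of [N'] outside [D] normalizing [D] lies in [M], hence in [N]; so [N' :&: N]
   exceeds [D], which maximality of [D] forbids unless [M' = M]. *)
have key M' N' : maximal_subalg br M' -> nilrad M' N' -> (D <= N')%VS -> D <> N' ->
    M' = M.
  move=> m' H' D' neD; apply: NNPP => neM.
  have [t [tN' tD tC]] := normalizer_grows (nilrad_subalg m' H') (nilrad_nil H') D' neD.
  have sub : (D <= N' :&: N)%VS.
    rewrite subv_cap D' /=; apply/subvP => x xD; apply/HN; split; last exact: nD.
    apply: (subvP CM); apply/HC => k kD; rewrite DE memv_cap.
    by rewrite (nilrad_subalg m1 H1) ?(nilrad_subalg m2 H2) ?(subvP D1) ?(subvP D2).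
  have E : (N' :&: N)%VS = D.
    apply: maxD => //; split; last by exists M', M, N', N.
    by apply: contraNneq D0 => E; rewrite -subv0 -E.
  move/negP: tD; apply; rewrite -E memv_cap tN' /=; apply/HN.
  by split; [apply: (subvP CM); apply/HC | apply: (nilrad_nil H')].
(* If [D = N1] then [N1] lies in [N2], so they agree by maximality, and [M1], [M2] are both the
   normalizer of the same subspace. *)
have ne1 : D <> N1.
  move=> E; have [_ _ max1] := nilrad_maximal_nil m1 H1 (not0 _ _ H1 D1).
  have N21 : N2 = N1.
    by apply: max1; [exact: nilrad_subalg H2 | exact: nilrad_nil H2 | rewrite -E].
  apply: ne12; rewrite N21 in H2.
  exact: nilrad_inj m1 m2 H1 H2 (not0 _ _ H1 D1).
have ne2 : D <> N2.
  move=> E; have [_ _ max2] := nilrad_maximal_nil m2 H2 (not0 _ _ H2 D2).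
  have N12 : N1 = N2.
    by apply: max2; [exact: nilrad_subalg H1 | exact: nilrad_nil H1 | rewrite -E].
  apply: ne12; rewrite N12 in H1.
  exact: nilrad_inj m1 m2 H1 H2 (not0 _ _ H2 D2).
by apply: ne12; rewrite (key M1 N1) // (key M2 N2).
Qed.

Lemma maximal_subalg_cap M1 M2 : maximal_subalg br M1 -> maximal_subalg br M2 ->
  M1 != M2 ->
  (forall x, x \in (M1 :&: M2)%VS -> acts_nil br x -> x = 0) /\
  abelian br (M1 :&: M2)%VS.
Proof.
move=> m1 m2 /eqP ne12.
have [N1 H1] := nilrad_exists m1; have [N2 H2] := nilrad_exists m2.
have N12 := nilrad_cap m1 m2 ne12 H1 H2.
split=> [x /memv_capP[x1 x2] nx|x y /memv_capP[x1 x2] /memv_capP[y1 y2]].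
  apply/eqP; rewrite -memv0 -N12 memv_cap.
  by apply/andP; split; [apply/H1 | apply/H2].
by apply/eqP; rewrite -memv0 -N12 memv_cap (nilrad_br m1 H1) ?(nilrad_br m2 H2).
Qed.

End Lie.

(** * Passage to the Frattini quotient *)

Section FrattiniQuotient.
Variables (F : fieldType) (V W : vectType F) (br : V -> V -> V) (brW : W -> W -> W).
Variables (pi : V -> W) (P : {vspace V}).
Hypotheses (HL : is_lie br) (HW : is_lie brW) (pi_hom : lie_hom br brW pi).
Hypotheses (pi_onto : forall w, exists x, pi x = w).
Hypotheses (pi_ker : forall x, pi x = 0 <-> x \in P).
Hypothesis frattiniP : is_frattini br P.

Lemma hom0 : pi 0 = 0.
Proof. by apply/pi_ker; apply: mem0v. Qed.

Lemma hom_iter n z x : pi (iter n (br z) x) = iter n (brW (pi z)) (pi x).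
Proof. by elim: n => //= n <-; rewrite pi_hom.2. Qed.

Lemma hom_acts_nil z : acts_nil br z -> acts_nil brW (pi z).
Proof.
move=> [n zn]; exists n => w; have [x <-] := pi_onto w.
by rewrite -hom_iter zn hom0.
Qed.

Lemma hom_preimage (S : {vspace W}) :
  exists S' : {vspace V}, forall x, x \in S' <-> pi x \in S.
Proof.
apply: subspace_of_pred => [|a x y xS yS]; first by rewrite hom0 mem0v.
by rewrite pi_hom.1 memv_lin.
Qed.

Lemma hom_image (T : {vspace V}) :
  exists T' : {vspace W}, forall w, w \in T' <-> exists x, x \in T /\ pi x = w.
Proof.
apply: subspace_of_pred => [|a _ _ [x [xT <-]] [y [yT <-]]].
  by exists 0; rewrite mem0v hom0.
by exists (a *: x + y); rewrite memv_lin // pi_hom.1.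
Qed.

Lemma hom_brsp (S : {vspace W}) (S' : {vspace V}) w :
  (forall x, x \in S' <-> pi x \in S) -> w \in brsp brW S S ->
  exists z, z \in brsp br S' S' /\ pi z = w.
Proof.
move=> HS; have [T HT] := hom_image (brsp br S' S').
suff /subvP sT : (brsp brW S S <= T)%VS by move/sT/HT.
apply: brsp_sub => u v; have [x <-] := pi_onto u; have [y <-] := pi_onto v.
move=> /HS xS /HS yS; apply/HT; exists (br x y).
by rewrite pi_hom.2 mem_brsp.
Qed.

Lemma preimage_full (S : {vspace W}) (S' : {vspace V}) :
  (forall x, x \in S' <-> pi x \in S) -> S' = fullv -> S = fullv.
Proof.
move=> HS S'E; apply/eqP; rewrite eqEsubv subvf /=; apply/subvP => w _.
by have [x <-] := pi_onto w; apply/HS; rewrite S'E memvf.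
Qed.

Lemma preimage_subalg (S : {vspace W}) (S' : {vspace V}) :
  (forall x, x \in S' <-> pi x \in S) -> subalg brW S -> subalg br S'.
Proof.
by move=> HS sS x y /HS xS /HS yS; apply/HS; rewrite pi_hom.2 sS.
Qed.

Lemma quotient_proper_triangulable :
  (forall S, subalg br S -> S != fullv -> triangulable_on br S) ->
  forall S, subalg brW S -> S != fullv -> triangulable_on brW S.
Proof.
move=> properT S sS nS w; have [S' HS] := hom_preimage S.
move=> /(hom_brsp HS)[z [zS <-]]; apply: hom_acts_nil.
apply: (properT S') zS; first exact: preimage_subalg HS sS.
by apply: contraNneq nS => /(preimage_full HS) ->.
Qed.

(* If [z] is nilpotent modulo [P], its Fitting null component [U] satisfies
   [U + P = V]; being supplemented by the Frattini ideal, [U] is [V]. *)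
Lemma quotient_not_triangulable : ~ triangulable br -> ~ triangulable brW.
Proof.
move=> notT tW; apply: notT => z zL; case: frattiniP => iP PM _.
have [T HT] : exists T : {vspace V}, forall x, x \in T <-> pi x \in brsp brW fullv fullv.
  exact: hom_preimage.
have /subvP sT : (brsp br fullv fullv <= T)%VS.
  by apply: brsp_sub => x y _ _; apply/HT; rewrite pi_hom.2 mem_brsp ?memvf.
have [m zm] := tW _ ((HT z).1 (sT z zL)).
have [n [U [HU sU decU]]] := fitting HL z.
have UP : (U + P)%VS = fullv.
  by apply: (decU P m iP) => x; apply/pi_ker; rewrite hom_iter zm.
exists n => y; apply/HU; suff -> : U = fullv by apply: memvf.
apply: NNPP => /eqP /(sub_maximal_subalg sU)[M [mM UM]]; have [_ /eqP nM _] := mM.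
by apply: nM; apply/eqP; rewrite eqEsubv subvf -UP subv_add UM PM.
Qed.

(** [M] contains [P], the kernel of [pi], so it is the full preimage of its image. *)
Lemma image_maximal (M : {vspace V}) : maximal_subalg br M ->
  exists M', maximal_subalg brW M' /\ forall x, x \in M <-> pi x \in M'.
Proof.
move=> mM; have [_ /(_ M mM) /subvP PM _] := frattiniP; have [sM nM maxM] := mM.
have [M' HM'] := hom_image M.
have HM x : x \in M <-> pi x \in M'.
  split=> [xM|/HM'[y [yM xy]]]; first by apply/HM'; exists x.
  rewrite -[x](subrK y) memvD // PM //; apply/pi_ker.
  by rewrite -[y]scale1r -scaleN1r scalerA mulN1r addrC pi_hom.1 xy scaleN1r addNr.
exists M'; split=> //; split.
- move=> _ _ /HM'[x [xM <-]] /HM'[y [yM <-]].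
  by rewrite -pi_hom.2; apply/HM; apply: sM.
- apply: contraNneq nM => M'E; rewrite eqEsubv subvf; apply/subvP => x _.
  by apply/HM; rewrite M'E memvf.
move=> T sT M'T; have [T' HT] := hom_preimage T.
have MT' : (M <= T')%VS by apply/subvP => x /HM/(subvP M'T)/HT.
case: (maxM T' (preimage_subalg HT sT) MT') => [T'E|/(preimage_full HT)]; last by right.
left; apply/vspaceP => w; have [x <-] := pi_onto w.
by apply/idP/idP => [/HT|/HM]; [rewrite T'E => /HM | rewrite -T'E => /HT].
Qed.

Lemma quotient_frattini_free (I : {vspace W}) : ideal brW I ->
  (forall M, maximal_subalg brW M -> (I <= M)%VS) -> I = 0%VS.
Proof.
move=> iI IM; have [I' HI] := hom_preimage I; have [_ _ maxP] := frattiniP.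
have /subvP I'P : (I' <= P)%VS.
  apply: maxP => [x y /HI yI|M /image_maximal[M' [mM' HM]]].
    by apply/HI; rewrite pi_hom.2 iI.
  by apply/subvP => x /HI /(subvP (IM M' mM')) /HM.
apply/eqP; rewrite -subv0; apply/subvP => w; have [x <-] := pi_onto w.
by move=> /HI/I'P/pi_ker ->; apply: mem0v.
Qed.

(** A proper ideal outside some maximal subalgebra would be supplemented by it, against
    [no_supplement]; one inside all of them vanishes. *)
Lemma quotient_no_ideal :
  (forall S, subalg br S -> S != fullv -> triangulable_on br S) ->
  ~ triangulable br -> forall I, ideal brW I -> I = 0%VS \/ I = fullv.
Proof.
move=> properT notT I iI; case: (eqVneq I fullv) => [|nI]; [by right | left].
apply: quotient_frattini_free => // M mM; apply/negPn/negP => IM.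
have [sM nM maxM] := mM.
apply: (no_supplement HW (quotient_proper_triangulable properT)
  (quotient_not_triangulable notT) sM nM iI nI).
case: (maxM _ (subalg_add_ideal HW sM iI) (addvSl _ _)) => // MI.
by move/negP: IM; case; rewrite -MI addvSr.
Qed.

End FrattiniQuotient.

Theorem theorem4p6 (F : fieldType) (V : vectType F) (br : V -> V -> V)
    (HL : is_lie br) :
  (* (1) *)
  (solvable br ->
   (forall S : {vspace V}, subalg br S -> S != fullv -> two_generated br S ->
      triangulable_on br S) ->
   triangulable br) /\
  (* (2) *)
  ((forall S : {vspace V}, subalg br S -> S != fullv -> triangulable_on br S) ->
   ~ triangulable br ->
   two_generated br fullv /\
   forall (P : {vspace V}), is_frattini br P ->
   forall (W : vectType F) (brW : W -> W -> W) (pi : V -> W),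
     is_lie brW -> lie_hom br brW pi -> (forall w : W, exists x, pi x = w) ->
     (forall x, pi x = 0 <-> x \in P) ->
     [/\ simple brW,
       (* (a) *)
       (forall M : {vspace W}, maximal_subalg brW M ->
          (abelian brW M /\ (forall x, x \in M -> acts_nil brW x -> x = 0))
          \/ (exists N, is_nil_of brW M N /\ N != 0%VS /\ maximal_nil brW N)),
       (* (b) *)
       (forall K N : {vspace W}, maximal_nil brW K -> K != 0%VS ->
          is_normalizer brW K N -> maximal_subalg brW N),
       (* (c) *)
       (forall M1 M2 : {vspace W}, maximal_subalg brW M1 ->
          maximal_subalg brW M2 -> M1 != M2 ->
          (forall x, x \in (M1 :&: M2)%VS -> acts_nil brW x -> x = 0) /\
          abelian brW (M1 :&: M2)%VS) &
       (* (d) *)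
       two_generated brW fullv]).
Proof.
split=> [solL two|properT notT].
  apply: solvable_triangulable => // S sS nS.
  apply: triangulable_of_two_generated => // T sT TS; apply: two => //.
  by apply: contraNneq nS => TE; rewrite eqEsubv subvf -TE.
split; first exact: full_two_generated.
move=> P fP W brW pi HW hom onto ker.
have properW := quotient_proper_triangulable HL hom onto ker properT.
have notW := quotient_not_triangulable HL HW hom ker fP notT.
have noI := quotient_no_ideal HL HW hom onto ker fP properT notT.
split.
(* An abelian quotient would be triangulable, since zero acts nilpotently with exponent 1. *)
- split=> //; apply/eqP => W0; apply: notW => z.
  by rewrite W0 memv0 => /eqP->; exists 1%N => y; apply: br0l.
- by move=> M; apply: maximal_subalg_dichotomy.
- by move=> K N; apply: maximal_nil_normalizer.
- by move=> M1 M2; apply: maximal_subalg_cap.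
- exact: full_two_generated.
Qed.
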